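(* Let $\Delta$ be an ideal triangulation of $S=S_{g,n}$, with set of ideal triangles $T$ and set of oriented edges $\underline{E}$. Then the semi-algebraic set $$\mathring{\mathcal C}(\Delta)=\{(\bar A,\bar a)\in\mathbb R_{>0}^{T}\times\mathbb R_{>0}^{\underline E}\mid \mathrm{Out}_{(\bar A,\bar a)}(e)>0\ \text{ for all edges } e\in\Delta\}$$ is homeomorphic to $\mathbb R_{>0}^{T+\underline E}$.
   Context: $S=S_{g,n}$ is a closed oriented surface of genus $g$ with a set $\mathcal P$ of $n\ge1$ points removed, $2g+n>2$. An ideal triangulation $\Delta$ of $S$ is (the intersection with $S$ of) a maximal collection of pairwise disjoint, pairwise non-isotopic (rel $\mathcal P$) essential arcs with endpoints in $\mathcal P$; its complementary regions are ideal triangles. An arc is essential if, whenever its complement in the closed surface has two components, neither is a disc meeting $\mathcal P$ only in the endpoints of the arc. $\mathcal A_\Delta=\mathbb R_{>0}^{T}\times\mathbb R_{>0}^{\underline E}=\mathbb R_{>0}^{T+\underline E}$ is the space of assignments of a positive real number to each ideal triangle (triangle parameters $\bar A$) and each oriented edge (edge parameters $\bar a$); each unoriented edge carries two edge parameters, one per orientation. Outitude. For an edge $e$ of $\Delta$, lift $e$ to the universal cover, with the two adjacent ideal triangles having positively ordered vertices $(v_0,v_1,v_2)$ and $(v_0,v_2,v_3)$, the lift of $e$ joining $v_0$ and $v_2$. Let $A$ and $B$ be the triangle parameters of these two triangles and let $e_{ij}$ be the parameter of the oriented edge from $v_i$ to $v_j$ (all parameters pulled back from $\Delta$). Put $e^+=e_{02}$,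 $e^-=e_{20}$, $a^-=e_{01}$, $b^+=e_{21}$, $c^+=e_{23}$, $d^-=e_{03}$. Then $$\mathrm{Out}(e)=A(e^+c^++e^-d^--e^+e^-)+B(e^+b^++e^-a^--e^+e^-).$$ *)

(* Defs.v *)
From HB Require Import structures.
From mathcomp Require Import all_boot all_order all_algebra.
From mathcomp Require Import all_classical all_reals all_analysis.
Set Implicit Arguments.
Unset Strict Implicit.
Unset Printing Implicit Defensive.
Import Order.TTheory GRing.Theory Num.Theory.
Import numFieldNormedType.Exports.
Local Open Scope classical_set_scope.
Local Open Scope ring_scope.

Definition homeomorphic (X Y : topologicalType) (A : set X) (B : set Y) : Prop :=
  exists (f : X -> Y) (h : Y -> X),
    [/\ f @` A `<=` B, h @` B `<=` A,
        {in A, cancel f h}, {in B, cancel h f} &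
        {within A, continuous f} /\ {within B, continuous h}].

Definition power_space (R : realType) (I : finType) : topologicalType :=
  {ptws I -> R}.

Definition positive_orthant (R : realType) (I : finType) :
    set (power_space R I) :=
  [set x : I -> R | forall i, 0 < x i].

Arguments positive_orthant R I : clear implicits.

Section Surfaces.
Variable R : realType.

Definition on_circle (x : R * R) (r t : R) : R * R :=
  (x.1 + r * cos t, x.2 + r * sin t).

(* For p injective near x and q an open embedding with q y = p x: the local
   homeomorphism q^-1 \o p sends small circles around x to curves winding once,
   counterclockwise, around y (theta is a continuous determination of the angle
   seen from y). *)
Definition co_oriented (M : topologicalType) (p q : R * R -> M) (x y : R * R) :
    Prop :=
  exists2 r0 : R, 0 < r0 & forall r, 0 < r < r0 ->
    exists rho theta : R -> R,
      [/\ continuous rho, continuous theta, forall t, 0 < rho t,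
          forall t, theta (t + pi *+ 2) = theta t + pi *+ 2 &
          forall t, p (on_circle x r t) = q (on_circle y (rho t) (theta t))].

(* Charts are given by their inverses, defined on the whole plane. *)
Definition open_embedding (M : topologicalType) (p : R * R -> M) : Prop :=
  [/\ injective p, continuous p & forall U, open U -> open (p @` U)].

Definition oriented_atlas (M : topologicalType) (O : set (R * R -> M)) : Prop :=
  [/\ forall p, O p -> open_embedding p,
      forall z : M, exists2 p, O p & range p z &
      forall p q, O p -> O q -> forall x y, p x = q y -> co_oriented p q x y].

Definition simple_closed_curve (M : topologicalType) (c : R -> M) : Prop :=
  [/\ continuous c, forall t, c (t + 1) = c t &
      forall s t : R, 0 <= s < 1 -> 0 <= t < 1 -> c s = c t -> s = t].

Definition nonseparating_family (M : topologicalType) (k : nat) : Prop :=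
  exists c : 'I_k -> R -> M,
    [/\ forall i, simple_closed_curve (c i),
        forall i j, i != j -> range (c i) `&` range (c j) = set0 &
        connected (~` \bigcup_i range (c i))].

(* The genus is the largest number of pairwise disjoint simple closed curves
   along which the surface can be cut without being disconnected. *)
Definition genus (M : topologicalType) (g : nat) : Prop :=
  nonseparating_family M g /\
  forall k, nonseparating_family M k -> (k <= g)%N.

(* S_{g,n} is [~` punctures], inside the closed surface [closed_surface]. *)
Record punctured_surface (g n : nat) := PuncturedSurface {
  closed_surface :> topologicalType;
  orientation : set (R * R -> closed_surface);
  punctures : set closed_surface;
  surface_hausdorff : hausdorff_space closed_surface;
  surface_compact : compact [set: closed_surface];
  surface_connected : connected [set: closed_surface];
  surface_oriented : oriented_atlas orientation;
  surface_genus : genus closed_surface g;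
  card_punctures : (punctures #= `I_n)%card }.

End Surfaces.

Arguments punctures {R g n} p.
Arguments orientation {R g n} p.

Section Triangulations.
Variables (R : realType) (g n : nat) (S : punctured_surface R g n).
Implicit Types alpha beta : R -> S.

(* Only the restriction of alpha to [0, 1] matters. *)
Definition is_arc alpha : Prop :=
  [/\ {within `[0, 1], continuous alpha},
      forall s t : R, 0 < s < 1 -> 0 < t < 1 -> alpha s = alpha t -> s = t,
      punctures S (alpha 0), punctures S (alpha 1) &
      forall t : R, 0 < t < 1 -> ~ punctures S (alpha t)].

Definition arc_set alpha : set S := alpha @` `[0, 1].
Definition arc_interior alpha : set S := alpha @` `]0, 1[.

(* In the first clause x and y lie in different components, so that the
   complement of the arc has two components. *)
Definition essential alpha : Prop :=
  forall x y : S, ~ arc_set alpha x -> ~ arc_set alpha y ->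
    let C := connected_component (~` arc_set alpha) x in
    ~ C y ->
    ~ (homeomorphic C [set: R * R] /\
       closure C `&` punctures S `<=` [set alpha 0; alpha 1]).

(* Isotopy rel punctures of unoriented arcs: the end of the isotopy is beta up
   to reparametrisation, possibly reversing the orientation. *)
Definition isotopic alpha beta : Prop :=
  exists H : R * R -> S,
    [/\ {within `[0, 1] `*` `[0, 1], continuous H},
        forall s : R, 0 <= s <= 1 -> is_arc (fun t => H (s, t)),
        forall t : R, 0 <= t <= 1 -> H (0, t) = alpha t &
        arc_set (fun t => H (1, t)) = arc_set beta].

Definition maximal_arc_system (E : finType) (arc : E -> R -> S) : Prop :=
  [/\ forall e, is_arc (arc e) /\ essential (arc e),
      forall e f, e != f -> arc_interior (arc e) `&` arc_interior (arc f) = set0,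
      forall e f, e != f -> ~ isotopic (arc e) (arc f) &
      forall beta, is_arc beta -> essential beta ->
        (forall e, arc_interior beta `&` arc_interior (arc e) = set0) ->
        exists e, isotopic beta (arc e)].

(* (e, true) is e with the direction of its parametrisation, (e, false) is e
   with the opposite direction. *)
Definition oriented_arc (E : finType) (arc : E -> R -> S) (o : E * bool)
    (t : R) : S :=
  if o.2 then arc o.1 t else arc o.1 (1 - t).

(* The model triangle has vertices 0 -> (0,0), 1 -> (1,0), 2 -> (0,1), in
   counterclockwise order; side i runs from vertex i to vertex i + 1 mod 3. *)
Definition model_triangle : set (R * R) :=
  [set x | [/\ 0 <= x.1, 0 <= x.2 & x.1 + x.2 <= 1]].
Definition model_interior : set (R * R) :=
  [set x | [/\ 0 < x.1, 0 < x.2 & x.1 + x.2 < 1]].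
Definition model_side (i : 'I_3) (s : R) : R * R :=
  match val i with
  | 0%N => (s, 0)
  | 1%N => (1 - s, s)
  | _ => (0, 1 - s)
  end.

(* An ideal triangulation: the arcs, together with the complementary regions.
   The region t is presented by a characteristic map [triangle_map t] from the
   closed model triangle, which lifts, away from the vertices, to an embedding
   in the universal cover of S.  [side (t, i)] is the oriented edge followed by
   side i of t, so that t lies to its left; every oriented edge is such a side
   for exactly one (t, i), which is given by [left_side]. *)
Record ideal_triangulation := IdealTriangulation {
  edge : finType;
  arc : edge -> R -> S;
  arcs_maximal : maximal_arc_system arc;
  triangle : finType;
  triangle_map : triangle -> R * R -> S;
  triangle_map_continuous :
    forall t, {within model_triangle, continuous triangle_map t};
  triangle_map_inj : forall t u x y, model_interior x -> model_interior y ->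
    triangle_map t x = triangle_map u y -> t = u /\ x = y;
  triangle_map_region : forall t x, model_interior x ->
    triangle_map t @` model_interior =
    connected_component (~` (punctures S `|` \bigcup_e arc_set (arc e)))
                        (triangle_map t x);
  triangles_cover : forall z : S,
    ~ (punctures S `|` \bigcup_e arc_set (arc e)) z ->
    exists t, (triangle_map t @` model_interior) z;
  triangle_map_oriented : forall t p x y,
    model_interior x -> orientation S p -> p y = triangle_map t x ->
    co_oriented (triangle_map t) p x y;
  side : triangle * 'I_3 -> edge * bool;
  left_side : edge * bool -> triangle * 'I_3;
  sideK : cancel side left_side;
  left_sideK : cancel left_side side;
  triangle_map_side : forall t i s, 0 <= s <= 1 ->
    triangle_map t (model_side i s) = oriented_arc arc (side (t, i)) s }.

Section Outitude.
Variable D : ideal_triangulation.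

Definition oriented_edge : finType := (edge D * bool)%type.

Definition reverse (o : oriented_edge) : oriented_edge := (o.1, ~~ o.2).

Definition next_side (c : triangle D * 'I_3) : triangle D * 'I_3 :=
  (c.1, ordS c.2).

Definition triangle_or_oriented_edge : finType :=
  (triangle D + oriented_edge)%type.

Definition parameters : topologicalType :=
  (power_space R (triangle D) * power_space R oriented_edge)%type.

(* The triangle (v0, v1, v2) lies to the left of the oriented edge v2 v0, and
   the triangle (v0, v2, v3) to the left of the oriented edge v0 v2.  Oij is the
   projection to S of the oriented edge from vi to vj. *)
Definition Out (x : parameters) (e : edge D) : R :=
  let: (tri, a) := x in
  let O02 : oriented_edge := (e, true) in
  let O20 := reverse O02 in
  let c012 := left_side O20 in
  let c023 := left_side O02 in
  let O01 := side (next_side c012) in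
  let O12 := side (next_side (next_side c012)) in
  let O23 := side (next_side c023) in
  let O30 := side (next_side (next_side c023)) in
  let A := tri c012.1 in
  let B := tri c023.1 in
  let ep := a O02 in
  let em := a O20 in
  let am := a O01 in
  let bp := a (reverse O12) in
  let cp := a O23 in
  let dm := a (reverse O30) in
  A * (ep * cp + em * dm - ep * em) + B * (ep * bp + em * am - ep * em).

Definition open_cell : set parameters :=
  [set x | [/\ positive_orthant R (triangle D) x.1,
               positive_orthant R oriented_edge x.2 &
               forall e, 0 < Out x e]].

End Outitude.
End Triangulations.

Arguments open_cell {R g n S} D.

(* Main.v *)
Require Import Defs.
From HB Require Import structures.
From mathcomp Require Import all_boot all_order all_algebra.
From mathcomp Require Import all_classical all_reals all_analysis.
From mathcomp Require Import ring lra.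
Set Implicit Arguments.
Unset Strict Implicit.
Unset Printing Implicit Defensive.
Import Order.TTheory GRing.Theory Num.Theory.
Import numFieldNormedType.Exports.
Local Open Scope classical_set_scope.
Local Open Scope ring_scope.

(** The outitude of [e] is a quadratic expression in the edge parameters, but each
    of its monomials contains a parameter of [e].  Write an edge parameter as
    [a o = b o * m o.1], where [m e] is the smaller of the two parameters of [e];
    thus [b] only records the ratios of the two parameters of each edge.  With
    the triangle parameters and [b] held fixed, [Out e / m e] is a linear form in
    [m] ([Out_affine]), so the slice of the open cell over a given choice of
    triangle parameters and ratios is an open convex polyhedral cone in the
    orthant of all positive [m].

    All these cones share the interior point [m = 1] ([Out_base_gt0]).  Indeed
    all edge parameters are then at least 1, and one of the two parameters of
    [e], say [e^+], equals 1; the factor of each triangle parameter in [Out e]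
    has the form [e^+ c + e^- d - e^+ e^- = c + e^- (d - 1)], with [c, d >= 1],
    and so is positive.

    Two convex sets that are open and share the centre 1 are homeomorphic by a
    radial map: move [1 + v] along its ray by a factor computed from the gauges
    of the two sets.  As both sets are given by finitely many affine
    inequalities, whose coefficients depend continuously on the triangle
    parameters and the ratios, the gauges are maxima of finitely many continuous
    functions of all the parameters.  Hence the radial maps of the slices
    ([to_orthant], with inverse [to_cell]) fit together to a homeomorphism from
    the open cell to the positive orthant. *)

(** * Finite maxima and pointwise topology *)

Section Preliminaries.
Context {R : realType}.

Lemma bigmaxZ (I : finType) (s : R) (F : I -> R) : 0 <= s ->
  \big[Num.max/0]_i (s * F i) = s * \big[Num.max/0]_i F i.
Proof.
move=> s0; apply: esym; apply: (big_endo (fun x => s * x)).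
  by move=> x y; rewrite maxr_pMr.
by rewrite mulr0.
Qed.

Lemma coordinate_continuous (I : finType) (i : I) :
  continuous (fun a : power_space R I => a i).
Proof. exact: (@proj_continuous I (fun=> R) i). Qed.

Lemma power_space_continuous_at (X : topologicalType) (I : finType)
    (f : X -> power_space R I) (x : X) :
  (forall i, {for x, continuous (fun y => f y i)}) -> {for x, continuous f}.
Proof.
move=> fc; apply/cvg_sup => i U [_ [[W oW <-] /= Wfx] WU].
by apply: filterS WU _; apply: (fc i); exact: open_nbhs_nbhs.
Qed.

Lemma continuous_bigmax (X : topologicalType) (I : finType) (F : I -> X -> R)
    (x : X) :
  (forall i, {for x, continuous (F i)}) ->
  {for x, continuous (fun y => \big[Num.max/0]_i F i y)}.
Proof.
move=> Fc; have max_continuous : continuous (fun p : R * R => Num.max p.1 p.2).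
  by move=> p; apply: continuous_max; [exact: cvg_fst|exact: cvg_snd].
by apply: (cvg_big max_continuous) => i _; exact: Fc.
Qed.

Section PointwiseOperations.
Context {X : topologicalType} {f h : X -> R} {x : X}.
Hypotheses (fc : {for x, continuous f}) (hc : {for x, continuous h}).

Lemma continuous_add : {for x, continuous (fun y => f y + h y)}.
Proof. exact: cvgD. Qed.

Lemma continuous_sub : {for x, continuous (fun y => f y - h y)}.
Proof. exact: cvgB. Qed.

Lemma continuous_mul : {for x, continuous (fun y => f y * h y)}.
Proof. exact: cvgM. Qed.

Lemma continuous_div : h x != 0 -> {for x, continuous (fun y => f y / h y)}.
Proof. by move=> h0; apply: cvgM => //; apply: cvgV. Qed.

End PointwiseOperations.

End Preliminaries.

(** * Edge minima and the central point of a slice *)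

Section Cell.
Variables (R : realType) (g n : nat) (S : punctured_surface R g n).
Variable D : ideal_triangulation S.
Implicit Types (x : parameters D) (e : edge D).

Definition positive x : Prop :=
  positive_orthant R (triangle D) x.1 /\
  positive_orthant R (oriented_edge D) x.2.

Definition edge_min x e : R := Num.min (x.2 (e, true)) (x.2 (e, false)).

(** The centre [m = 1] of the slice through [x]. *)
Definition base x : parameters D :=
  (x.1, fun o => x.2 o / edge_min x o.1).

(** The homothety of factor [s] centred at [base x], within the slice of [x]. *)
Definition slide (s : R) x : parameters D :=
  (x.1, fun o => (base x).2 o * (1 + s * (edge_min x o.1 - 1))).

Lemma edge_min_gt0 x e : positive x -> 0 < edge_min x e.
Proof. by move=> [_ a0]; rewrite lt_min !a0. Qed.

Lemma edge_min_scale x (m : edge D -> R) e : 0 < m e ->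
  edge_min (x.1, fun o => x.2 o * m o.1) e = edge_min x e * m e.
Proof. by move=> m0; rewrite /edge_min /= minr_pMl // ltW. Qed.

Lemma edge_min_base x e : positive x -> edge_min (base x) e = 1.
Proof.
move=> x0; have m0 := edge_min_gt0 e x0.
rewrite (@edge_min_scale x (fun e => (edge_min x e)^-1)) ?invr_gt0 //.
by rewrite divff ?gt_eqF.
Qed.

Lemma base_positive x : positive x -> positive (base x).
Proof.
move=> x0; split; first exact: x0.1.
by move=> o /=; rewrite divr_gt0 ?edge_min_gt0 //; exact: x0.2.
Qed.

(** Both parameters of [e] are at least 1 and one of them is 1, which makes the
    contribution of each of the two adjacent triangles positive. *)
Lemma Out_base_gt0 x e : positive x -> 0 < Out (base x) e.
Proof.
move=> x0; have [A0 b0] := base_positive x0.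
have b1 (o : oriented_edge D) : 1 <= (base x).2 o.
  case: o => f c; rewrite -(edge_min_base f x0) /edge_min.
  by case: c; rewrite ge_min lexx ?orbT.
have := edge_min_base e x0; rewrite /edge_min /Out.
case: (base x) A0 b0 b1 => tri a /= A0 _ b1 min1.
(* With one of the two parameters equal to 1 and the other one y >= 1, this is
   c + y (d - 1) or d + y (c - 1). *)
have corner_gt0 c d : 1 <= c -> 1 <= d ->
    0 < a (e, true) * c + a (e, false) * d - a (e, true) * a (e, false).
  have := b1 (e, true); have := b1 (e, false).
  by move: min1; rewrite minElt; case: ifP => _ -> *; nra.
by apply: addr_gt0; apply: mulr_gt0; rewrite ?A0 //; apply: corner_gt0; exact: b1.
Qed.

(** [Out e / m e] is linear in [m], hence affine on the segment from 1 to [m];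
    the identity is cleared of the denominators [m e] and
    [1 + s * (m e - 1)]. *)
Lemma Out_affine x (m : edge D -> R) (s : R) e :
  m e * Out (x.1, fun o => x.2 o * (1 + s * (m o.1 - 1))) e =
  (1 + s * (m e - 1)) *
    ((1 - s) * m e * Out x e + s * Out (x.1, fun o => x.2 o * m o.1) e).
Proof. by case: x => tri a; rewrite /Out /=; ring. Qed.

Lemma unslide x : positive x ->
  (x.1, fun o => (base x).2 o * edge_min x o.1) = x :> parameters D.
Proof.
move=> x0; case: x x0 => tri a x0; congr pair; apply/funext => o /=.
by rewrite divfK // gt_eqF // edge_min_gt0.
Qed.

Lemma slide1 x : positive x -> slide 1 x = x.
Proof.
move=> x0; rewrite -[RHS]unslide //; congr pair; apply/funext => o.
by rewrite mul1r addrC subrK.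
Qed.

(** * Gauges *)

(** The ray [slide s x], [s >= 0], which starts at the centre and passes through
    [x] at [s = 1], leaves the positive orthant at [s = (orthant_gauge x)^-1] and
    the open cell at [s = (cell_gauge x)^-1]; a gauge 0 means that it never
    does. *)
Definition orthant_gauge x : R := \big[Num.max/0]_e (1 - edge_min x e).

(** The affine function of the position on that ray that vanishes at
    [base x] and reaches 1 where the outitude of [e] becomes 0. *)
Definition defect x e : R := 1 - Out x e / (edge_min x e * Out (base x) e).

Definition cell_gauge x : R :=
  Num.max (orthant_gauge x) (\big[Num.max/0]_e defect x e).

Lemma orthant_gauge_ge0 x : 0 <= orthant_gauge x.
Proof. exact: bigmax_ge_id. Qed.

Lemma orthant_gauge_le_cell x : orthant_gauge x <= cell_gauge x.
Proof. by rewrite le_max lexx. Qed.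

Lemma edge_min_le_gauge x e : 1 - edge_min x e <= orthant_gauge x.
Proof. exact: (@le_bigmax _ _ _ 0 (fun e => 1 - edge_min x e)). Qed.

Lemma orthant_gauge_lt1 x : positive x -> orthant_gauge x < 1.
Proof.
move=> x0; apply/bigmax_ltP; split=> // e _.
by have := edge_min_gt0 e x0; lra.
Qed.

Lemma cell_gauge_lt1P x : positive x ->
  cell_gauge x < 1 <-> forall e, 0 < Out x e.
Proof.
move=> x0; rewrite gt_max orthant_gauge_lt1 //=.
have defect_lt1 e : (defect x e < 1) = (0 < Out x e).
  rewrite /defect ltrBlDr ltrDl pmulr_lgt0 // invr_gt0 mulr_gt0 //.
    exact: edge_min_gt0.
  exact: Out_base_gt0.
split=> [/bigmax_ltP[_ h] e|h]; first by rewrite -defect_lt1 h.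
by apply/bigmax_ltP; split=> // e _; rewrite defect_lt1.
Qed.

Lemma open_cellP x : open_cell D x <-> positive x /\ cell_gauge x < 1.
Proof.
split=> [[A0 a0 O0]|[x0 /(cell_gauge_lt1P x0) O0]]; last first.
  by split; [exact: x0.1|exact: x0.2|].
by have x0 : positive x by []; split=> //; apply/cell_gauge_lt1P.
Qed.

Section Slide.
Variables (x : parameters D) (s : R).
Hypotheses (x_gt0 : positive x) (s_ge0 : 0 <= s)
  (s_lt : s * orthant_gauge x < 1).

Let weight_gt0 e : 0 < 1 + s * (edge_min x e - 1).
Proof.
have : s * (1 - edge_min x e) < 1.
  by apply: le_lt_trans s_lt; rewrite ler_wpM2l ?edge_min_le_gauge.
by lra.
Qed.

Lemma slide_positive : positive (slide s x).
Proof.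
split; first exact: x_gt0.1.
by move=> o; rewrite mulr_gt0 //; exact: (base_positive x_gt0).2.
Qed.

Lemma edge_min_slide e :
  edge_min (slide s x) e = 1 + s * (edge_min x e - 1).
Proof.
rewrite (@edge_min_scale (base x) (fun e => 1 + s * (edge_min x e - 1))) //.
by rewrite edge_min_base // mul1r.
Qed.

Lemma base_slide : base (slide s x) = base x.
Proof.
congr pair; apply/funext => o; rewrite edge_min_slide /=.
by rewrite mulfK // gt_eqF.
Qed.

Lemma slide_slide t : slide t (slide s x) = slide (t * s) x.
Proof.
rewrite {1}/slide base_slide; congr pair; apply/funext => o.
by rewrite edge_min_slide; ring.
Qed.

Lemma orthant_gauge_slide : orthant_gauge (slide s x) = s * orthant_gauge x.
Proof.
rewrite -bigmaxZ //; apply: eq_bigr => e _.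
by rewrite edge_min_slide; ring.
Qed.

(** By [Out_affine], divided by the edge minimum the outitude is an affine
    function along the segment, so its defect from the value at the centre
    scales with the distance from the centre. *)
Lemma defect_slide e : defect (slide s x) e = s * defect x e.
Proof.
rewrite /defect base_slide edge_min_slide.
have := Out_affine (base x) (edge_min x) s e.
rewrite (unslide x_gt0) -/(slide s x).
have := edge_min_gt0 e x_gt0; have := Out_base_gt0 e x_gt0.
have := weight_gt0 e.
move: (Out (slide s x) e) (Out (base x) e) (Out x e) (edge_min x e).
move=> O_slide O_base O_x m w0 base0 m0 affine.
have -> : O_slide = (1 + s * (m - 1)) * ((1 - s) * m * O_base + s * O_x) / m.
  by rewrite -affine; field; rewrite gt_eqF.
by field; rewrite !gt_eqF.
Qed.

Lemma cell_gauge_slide : cell_gauge (slide s x) = s * cell_gauge x.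
Proof.
rewrite /cell_gauge maxr_pMr // orthant_gauge_slide; congr Num.max.
by rewrite -bigmaxZ //; apply: eq_bigr => e _; exact: defect_slide.
Qed.

End Slide.

(** * The radial homeomorphism *)

(** A displacement [v] from the centre, with cell gauge [p] and orthant gauge [q],
    becomes [v / (1 - p + q)].  This is the composite of [v / (1 - p)], which
    sends the slice of the cell onto the whole vector space, with [v / (1 + q)],
    which sends that space onto the slice of the orthant; the composite stays
    inside the orthant.  The inverse has the same form, with the two gauges
    exchanged. *)
Definition to_orthant x : parameters D :=
  slide (1 - cell_gauge x + orthant_gauge x)^-1 x.

Definition to_cell x : parameters D :=
  slide (1 - orthant_gauge x + cell_gauge x)^-1 x.

Lemma cell_den_gt0 x : cell_gauge x < 1 ->
  0 < 1 - cell_gauge x + orthant_gauge x.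
Proof. by have := orthant_gauge_ge0 x; lra. Qed.

Lemma orthant_den_gt0 x : 0 < 1 - orthant_gauge x + cell_gauge x.
Proof. by have := orthant_gauge_le_cell x; lra. Qed.

(** After sliding by [s = (1 - p + q)^-1] the gauges [p] and [q] become [s * p]
    and [s * q], and [1 - s * q + s * p = s]: exchanging the gauges undoes the
    slide. *)
Lemma slide_back x p q (s := (1 - p + q)^-1) : positive x ->
  0 < 1 - p + q -> s * orthant_gauge x < 1 ->
  slide (1 - s * q + s * p)^-1 (slide s x) = x.
Proof.
move=> x0 d0 s_lt; have s0 : 0 <= s by rewrite invr_ge0 ltW.
rewrite slide_slide // -[RHS]slide1 //; congr slide.
have -> : 1 - s * q + s * p = s by rewrite /s; field; rewrite gt_eqF.
by rewrite mulVf // invr_neq0 // gt_eqF.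
Qed.

Lemma to_orthantP x : positive x -> cell_gauge x < 1 ->
  positive (to_orthant x) /\ to_cell (to_orthant x) = x.
Proof.
move=> x0 px; have d0 := cell_den_gt0 px; rewrite /to_cell /to_orthant.
have s0 := ltW d0; rewrite -invr_ge0 in s0.
have s_lt : (1 - cell_gauge x + orthant_gauge x)^-1 * orthant_gauge x < 1.
  by rewrite mulrC ltr_pdivrMr //; lra.
split; first exact: slide_positive.
by rewrite orthant_gauge_slide // cell_gauge_slide // slide_back.
Qed.

Lemma to_cellP x : positive x ->
  [/\ positive (to_cell x), cell_gauge (to_cell x) < 1 &
      to_orthant (to_cell x) = x].
Proof.
move=> x0; have d0 := orthant_den_gt0 x; rewrite /to_cell /to_orthant.
have s0 := ltW d0; rewrite -invr_ge0 in s0.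
have qx := orthant_gauge_lt1 x0; have le_qp := orthant_gauge_le_cell x.
have s_lt : (1 - orthant_gauge x + cell_gauge x)^-1 * orthant_gauge x < 1.
  by rewrite mulrC ltr_pdivrMr //; lra.
split; first exact: slide_positive.
  by rewrite cell_gauge_slide // mulrC ltr_pdivrMr //; lra.
by rewrite orthant_gauge_slide // cell_gauge_slide // slide_back.
Qed.

(** * Continuity *)

Lemma triangle_parameter_continuous (t : triangle D) :
  continuous (fun x => x.1 t).
Proof.
move=> x; apply: (@cvg_comp _ _ _ fst (fun a : power_space R _ => a t)).
  exact: cvg_fst.
exact: coordinate_continuous.
Qed.

Lemma edge_parameter_continuous (o : oriented_edge D) :
  continuous (fun x => x.2 o).
Proof.
move=> x; apply: (@cvg_comp _ _ _ snd (fun a : power_space R _ => a o)).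
  exact: cvg_snd.
exact: coordinate_continuous.
Qed.

Lemma parameters_continuous_at (X : topologicalType) (f : X -> parameters D)
    (y : X) :
  (forall t, {for y, continuous (fun z => (f z).1 t)}) ->
  (forall o, {for y, continuous (fun z => (f z).2 o)}) ->
  {for y, continuous f}.
Proof.
move=> f1 f2.
have -> : f = (fun z => ((f z).1, (f z).2)) by apply/funext => z; case: (f z).
have c1 := power_space_continuous_at f1; have c2 := power_space_continuous_at f2.
exact: (cvg_pair c1 c2).
Qed.

Lemma edge_min_continuous e : continuous (edge_min ^~ e).
Proof. by move=> x; apply: continuous_min; exact: edge_parameter_continuous. Qed.

Lemma Out_continuous e : continuous (fun x => Out x e).
Proof.
have -> : (fun x => Out x e) = (fun x => Out (x.1, x.2) e).
  by apply/funext => -[].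
have cM o o' x : {for x, continuous (fun x => x.2 o * x.2 o')}.
  by apply: continuous_mul; exact: edge_parameter_continuous.
(* The contribution of one of the two adjacent triangles. *)
have half t o1 o2 o3 o4 o5 o6 x :
    {for x, continuous (fun x => x.1 t *
    (x.2 o1 * x.2 o2 + x.2 o3 * x.2 o4 - x.2 o5 * x.2 o6))}.
  apply: continuous_mul; first exact: triangle_parameter_continuous.
  by apply: continuous_sub; [apply: continuous_add; exact: cM|exact: cM].
move=> x; rewrite /Out /=.
exact: (continuous_add (half _ _ _ _ _ _ _ x) (half _ _ _ _ _ _ _ x)).
Qed.

Section ContinuityAt.
Variable x : parameters D.
Hypothesis x_gt0 : positive x.

Lemma base_continuous_at : {for x, continuous base}.
Proof.
apply: parameters_continuous_at => [t|o].
  exact: triangle_parameter_continuous.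
apply: continuous_div; last by rewrite gt_eqF // edge_min_gt0.
  exact: edge_parameter_continuous.
exact: edge_min_continuous.
Qed.

Lemma orthant_gauge_continuous_at : {for x, continuous orthant_gauge}.
Proof.
apply: continuous_bigmax => e.
by apply: continuous_sub; [exact: cst_continuous|exact: edge_min_continuous].
Qed.

Lemma cell_gauge_continuous_at : {for x, continuous cell_gauge}.
Proof.
apply: continuous_max; first exact: orthant_gauge_continuous_at.
apply: continuous_bigmax => e; apply: continuous_sub; first exact: cst_continuous.
apply: continuous_div; first exact: Out_continuous.
  apply: continuous_mul; first exact: edge_min_continuous.
  apply: (@cvg_comp _ _ _ base (fun y => Out y e)).
    exact: base_continuous_at.
  exact: Out_continuous.
by rewrite mulf_neq0 // gt_eqF // ?edge_min_gt0 ?Out_base_gt0.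
Qed.

Lemma slide_continuous_at (s : parameters D -> R) : {for x, continuous s} ->
  {for x, continuous (fun y => slide (s y) y)}.
Proof.
move=> sc; apply: parameters_continuous_at => [t|o].
  exact: triangle_parameter_continuous.
apply: continuous_mul.
  apply: (@cvg_comp _ _ _ base (fun y : parameters D => y.2 o)).
    exact: base_continuous_at.
  exact: edge_parameter_continuous.
apply: continuous_add; first exact: cst_continuous.
apply: continuous_mul => //; apply: continuous_sub; last exact: cst_continuous.
exact: edge_min_continuous.
Qed.

Lemma to_orthant_continuous_at : cell_gauge x < 1 ->
  {for x, continuous to_orthant}.
Proof.
move=> px; apply: slide_continuous_at; apply: continuousV.
  by rewrite gt_eqF // cell_den_gt0.
apply: continuous_add; last exact: orthant_gauge_continuous_at.
by apply: continuous_sub; [exact: cst_continuous|exact: cell_gauge_continuous_at].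
Qed.

Lemma to_cell_continuous_at : {for x, continuous to_cell}.
Proof.
apply: slide_continuous_at; apply: continuousV.
  by rewrite gt_eqF // orthant_den_gt0.
apply: continuous_add; last exact: cell_gauge_continuous_at.
by apply: continuous_sub; [exact: cst_continuous|exact: orthant_gauge_continuous_at].
Qed.

End ContinuityAt.

(** * From pairs of families to a single family *)

Definition join x : power_space R (triangle_or_oriented_edge D) :=
  fun i => match i with inl t => x.1 t | inr o => x.2 o end.

Definition split (z : power_space R (triangle_or_oriented_edge D)) :
    parameters D :=
  (fun t => z (inl t), fun o => z (inr o)).

Lemma joinK : cancel join split.
Proof. by case. Qed.

Lemma splitK : cancel split join.
Proof. by move=> z; apply/funext => -[]. Qed.

Lemma join_continuous : continuous join.
Proof.
move=> x; apply: power_space_continuous_at => -[t|o].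
  exact: triangle_parameter_continuous.
exact: edge_parameter_continuous.
Qed.

Lemma split_continuous : continuous split.
Proof.
by move=> z; apply: parameters_continuous_at => i; exact: coordinate_continuous.
Qed.

Lemma join_positive x :
  positive_orthant R (triangle_or_oriented_edge D) (join x) <-> positive x.
Proof.
split=> [z0|[A0 a0] [t|o]]; [|exact: A0|exact: a0].
by split=> [t|o]; [exact: (z0 (inl t))|exact: (z0 (inr o))].
Qed.

End Cell.

Theorem theorem5p2 (R : realType) (g n : nat) (hn : (1 <= n)%N)
    (hgn : (2 < 2 * g + n)%N) (S : punctured_surface R g n)
    (D : ideal_triangulation S) :
  homeomorphic (open_cell D)
    (positive_orthant R (triangle_or_oriented_edge D)).
Proof.
exists (@join _ _ _ _ D \o @to_orthant _ _ _ _ D).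
exists (@to_cell _ _ _ _ D \o @split _ _ _ _ D).
have split_positive (z : power_space R (triangle_or_oriented_edge D)) :
    positive_orthant R _ z -> positive (split z).
  by move=> z0; apply/join_positive; rewrite splitK.
split.
- move=> _ [x /open_cellP[x0 px] <-].
  by apply/join_positive; have [] := to_orthantP x0 px.
- move=> _ [z z0 <-]; apply/open_cellP.
  by have [] := to_cellP (split_positive z z0).
- move=> x /set_mem/open_cellP[x0 px] /=.
  by rewrite joinK; have [] := to_orthantP x0 px.
- move=> z /set_mem z0 /=.
  by have [_ _ ->] := to_cellP (split_positive z z0); rewrite splitK.
split; apply: continuous_in_subspaceT.
- move=> x /set_mem/open_cellP[x0 px]; apply: continuous_comp.
    exact: to_orthant_continuous_at.
  exact: join_continuous.
- move=> z /set_mem z0; apply: continuous_comp; first exact: split_continuous.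
  exact/to_cell_continuous_at/split_positive.
Qed.
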